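(* Let $A$ be a finite set and let $X \subset A^{\mathbb{Z}}$ be a sofic subshift. Then $X$ is strongly irreducible if and only if it is topologically mixing.
   Context: $A^{\mathbb{Z}}$ is the set of all maps $x \colon \mathbb{Z} \to A$ with the product of the discrete topologies, and $\mathbb{Z}$ acts on it by $(gx)(h) = x(h-g)$. A subshift is a closed $\mathbb{Z}$-invariant subset. Sofic: given a finite $A$-labeled graph $\mathcal{G}$ (a finite directed graph whose edges are labeled by elements of $A$), $X_{\mathcal{G}} \subset A^{\mathbb{Z}}$ is the set of all configurations that are the label sequence of some bi-infinite path in $\mathcal{G}$; it is a subshift. A subshift $X$ is sofic if $X = X_{\mathcal{G}}$ for some finite $A$-labeled graph $\mathcal{G}$. Strongly irreducible: for subsets $\Omega,\Delta \subset \mathbb{Z}$ put $\Omega^{+\Delta} = \{g \in \mathbb{Z} : (g+\Delta) \cap \Omega \neq \varnothing\}$. $X$ is strongly irreducible if there is a finite subset $\Delta \subset \mathbb{Z}$ such that for all finite subsets $\Omega_1,\Omega_2 \subset \mathbb{Z}$ with $\Omega_1^{+\Delta} \cap \Omega_2 = \varnothing$ and all $x_1,x_2 \in X$ there exists $x \in X$ coinciding with $x_1$ on $\Omega_1$ and with $x_2$ on $\Omega_2$. Topologically mixing: for any nonempty open subsets $U,V$ of $X$ there is a finite subset $F \subset \mathbb{Z}$ such that $U \cap gV \neq \varnothing$ for all $g \in \mathbb{Z}\setminus F$. *)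

(* Defs.v *)
From mathcomp Require Import all_boot all_order all_algebra.
From mathcomp Require Import boolp classical_sets functions cardinality topology.

Set Implicit Arguments.
Unset Strict Implicit.
Unset Printing Implicit Defensive.

Import GRing.Theory.
Local Open Scope classical_set_scope.
Local Open Scope ring_scope.

Definition config (A : finType) := {ptws int -> discrete_topology A}.

Definition shift (A : finType) (g : int) (x : config A) : config A :=
  fun h => x (h - g).

Definition subshift (A : finType) (X : set (config A)) : Prop :=
  closed X /\ forall (g : int) (x : config A), X x -> X (shift g x).

(* Parallel edges are allowed, possibly with equal labels. *)
Record labeled_graph (A : finType) := LabeledGraph {
  vertex : finType;
  edge : finType;
  source : edge -> vertex;
  target : edge -> vertex;
  label : edge -> A
}.

Definition biinfinite_path (A : finType) (G : labeled_graph A)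
    (p : int -> edge G) : Prop :=
  forall n : int, target (p n) = source (p (n + 1)).

Definition graph_shift (A : finType) (G : labeled_graph A) : set (config A) :=
  [set x | exists2 p : int -> edge G,
             biinfinite_path p & forall n : int, x n = label (p n)].

Definition sofic (A : finType) (X : set (config A)) : Prop :=
  exists G : labeled_graph A, X = graph_shift G.

Definition dilation (Omega Delta : set int) : set int :=
  [set g | [set g + d | d in Delta] `&` Omega !=set0].

Definition strongly_irreducible (A : finType) (X : set (config A)) : Prop :=
  exists2 Delta : set int, finite_set Delta &
    forall Omega1 Omega2 : set int,
      finite_set Omega1 -> finite_set Omega2 ->
      dilation Omega1 Delta `&` Omega2 = set0 ->
      forall x1 x2 : config A, X x1 -> X x2 ->
      exists x : config A,
        [/\ X x, forall h : int, Omega1 h -> x h = x1 h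
               & forall h : int, Omega2 h -> x h = x2 h].

(* The carrier of [subspace X] is all of [config A], with the points outside X
   isolated; its open sets that lie in X are the relatively open subsets of X. *)
Definition open_in (A : finType) (X U : set (config A)) : Prop :=
  U `<=` X /\ open (U : set (subspace X)).

Definition topologically_mixing (A : finType) (X : set (config A)) : Prop :=
  forall U V : set (config A),
    open_in X U -> open_in X V -> U !=set0 -> V !=set0 ->
    exists2 F : set int, finite_set F &
      forall g : int, ~ F g -> U `&` (shift g @` V) !=set0.

(* Main.v *)
Require Import Defs.
From mathcomp Require Import all_boot all_order all_algebra.
From mathcomp Require Import boolp classical_sets functions cardinality topology.
From mathcomp Require Import zify.

(** By mixing, any two words of the language of a sofic shift can be joined by
    a connecting word of any sufficiently large length.  Whether a given length
    works depends only on the set of vertices of the graph at which a path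
    reading the first word can end and the set of vertices at which a path
    reading the second word can start.  There are finitely many such pairs of
    sets, so a single gap length serves for all pairs of words; gluing from left
    to right, one run of coordinates at a time, gives strong irreducibility. *)

Set Implicit Arguments.
Unset Strict Implicit.
Unset Printing Implicit Defensive.

Import Order.TTheory GRing.Theory Num.Theory.
Local Open Scope classical_set_scope.
Local Open Scope ring_scope.

(** * Bounded sets of integers *)

Lemma finite_set_int_bounded (F : set int) :
  finite_set F -> exists M : nat, forall h, F h -> (`|h| <= M)%N.
Proof.
move=> /finite_seqP[s ->]; exists (\max_(h <- s) `|h|%N) => h /= hs.
exact: (@leq_bigmax_seq _ s xpredT (fun h : int => `|h|%N)).
Qed.

Lemma finite_set_int_ball (N : nat) : finite_set [set h : int | (`|h| <= N)%N].
Proof.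
pose s : seq int := [seq (k%:Z - N%:Z)%R | k <- iota 0 (2 * N).+1].
apply: (sub_finite_set _ (finite_seq s)) => h /= hN.
apply/mapP; exists `|(h + N%:Z)%R|%N; last by lia.
by rewrite mem_iota; lia.
Qed.

Lemma exists_max_int (S : set int) (B : int) (n : nat) :
  (forall h : int, S h -> B <= h < B + n%:Z) -> S !=set0 ->
  exists2 l, S l & forall h : int, S h -> h <= l.
Proof.
move=> SB [s Ss].
pose P k := `[< S (B + k%:Z) >].
have exP : exists k, P k.
  exists `|s - B|%N; apply/asboolP; have := SB _ Ss.
  by move=> ?; rewrite (_ : B + _ = s) //; lia.
have ubP k : P k -> (k <= n)%N by move=> /asboolP/SB; lia.
case: (ex_maxnP exP ubP) => k /asboolP Sk kmax.
exists (B + k%:Z) => // h Sh; have := SB _ Sh => hB.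
have : P `|h - B|%N by apply/asboolP; rewrite (_ : B + _ = h) //; lia.
by move=> /kmax; lia.
Qed.

(** * Cylinders as a neighbourhood basis *)

Section Topology.
Variable A : finType.
Implicit Types (x z u : config A) (P X U V : set (config A)).

Definition cylinder (N : nat) x : set (config A) :=
  [set z | forall h : int, (`|h| <= N)%N -> z h = x h].

Lemma near_coord x (h : int) : nbhs x [set z : config A | z h = x h].
Proof.
(* [pointwise_cvgP] wants a topological index type, which [int] is not. *)
have /(@pointwise_cvgP (discrete_topology int) (discrete_topology A) _ x _) :
  nbhs x --> x by [].
by move=> /(_ h [set x h]); apply; exact: discrete_set1.
Qed.

Lemma nbhs_cylinder N x : nbhs x (cylinder N x).
Proof.
have /finite_seqP[s sN] := finite_set_int_ball N.
have : nbhs x [set z : config A | forall h, h \in s -> z h = x h].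
  elim: s {sN} => [|k s IHs]; first exact: filterE.
  apply: filterS (filterI (near_coord x k) IHs) => z [zk zs] h.
  by rewrite inE => /orP[/eqP ->|/zs].
apply: filterS => z zs h hN; apply: zs.
by have : [set h : int | (`|h| <= N)%N] h by []; rewrite sN.
Qed.

(** Otherwise each cylinder would contain a point [z_ N] outside [P]; these points converge to [x]
    coordinatewise, so they eventually enter [P]. *)
Lemma nbhsP_cylinder x P : nbhs x P -> exists N, cylinder N x `<=` P.
Proof.
move=> xP; apply: contrapT => /forallNP noN.
have /choice[z_ z_P] : forall N, exists z, cylinder N x z /\ ~ P z.
  by move=> N; apply: contrapT => /forallNP H; apply: (noN N) => z zN;
    apply: contrapT => nPz; exact: (H z).
have : z_ @ \oo --> x.
  apply/(@pointwise_cvgP (discrete_topology int) (discrete_topology A)) => h V /= /nbhs_singleton Vx.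
  exists `|h|%N => // n /= hn.
  by rewrite /= (proj1 (z_P n) h hn).
by move=> /(_ _ xP)[n _ /(_ n (leqnn n))]; exact: (proj2 (z_P n)).
Qed.

Lemma open_in_cylinder N X x : open_in X (X `&` cylinder N x).
Proof.
split; first by move=> z [].
rewrite open_subspaceTI; apply: open_subspaceW; rewrite openE => z zx.
apply: filterS (nbhs_cylinder N z) => w wz h hN.
by rewrite wz // zx.
Qed.

Lemma open_in_sub_cylinder X U u :
  open_in X U -> U u -> exists N, X `&` cylinder N u `<=` U.
Proof.
move=> [UX /open_subspaceP[V oV VX]] Uu.
have Vu : V u.
  have : (U `&` X) u by split=> //; exact: UX.
  by rewrite -VX => -[].
have /nbhsP_cylinder[N NV] : nbhs u V by exact: open_nbhs_nbhs.
exists N => z [Xz zN].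
have : (V `&` X) z by split=> //; exact: NV.
by rewrite VX => -[].
Qed.

End Topology.

(** * From strong irreducibility to mixing *)

Lemma strongly_irreducible_mixing (A : finType) (X : set (config A)) :
  (forall g x, X x -> X (shift g x)) ->
  strongly_irreducible X -> topologically_mixing X.
Proof.
move=> shX [D finD irrX] U V oU oV [u Uu] [v Vv].
have [N NU] := open_in_sub_cylinder oU Uu.
have [M MV] := open_in_sub_cylinder oV Vv.
have [K KD] := finite_set_int_bounded finD.
(* For larger [|g|], the ball of radius [N] about 0 and that of radius [M] about [g] are more than
   [K] apart, while [K] bounds [D]. *)
exists [set g : int | (`|g| <= N + M + K)%N]; first exact: finite_set_int_ball.
move=> g /= /negP; rewrite -ltnNge => gF.
have [||||x [Xx xu xv]] := irrX [set h : int | (`|h| <= N)%N]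
  [set h : int | (`|h - g| <= M)%N] (finite_set_int_ball N) _ _
  u (shift g v).
- apply: sub_finite_set (finite_set_int_ball (M + `|g|)%N) => h /=; lia.
- rewrite -subset0 => h [[_ [[d Dd <-] /= hd]] /= hg].
  by have := KD _ Dd; lia.
- exact: oU.1.
- by apply: shX; exact: oV.1.
exists x; split; first exact: NU.
exists (shift (- g) x).
  apply: MV; split; first exact: shX.
  move=> h hM; rewrite /shift opprK xv /=; last by lia.
  by rewrite /shift addrK.
by apply/funext => h; rewrite /shift opprK subrK.
Qed.

(** * From a uniform gap to strong irreducibility *)

(* [uniform_gap N X] is the specification property for two words. *)
Definition uniform_gap (A : finType) (N : nat) (X : set (config A)) : Prop :=
  forall (x y : config A) (a m n b : int), X x -> X y -> m + N%:Z <= n ->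
  exists z : config A, [/\ X z, forall h : int, a <= h < m -> z h = x h
                         & forall h : int, n <= h < b -> z h = y h].

(** Induction on the length [n] of a window containing both sets. Cut after the last point of the
    set that ends first: the induction hypothesis handles everything up to the cut, and one use of
    the gap appends the rest of the other set. *)
Lemma uniform_gap_glue (A : finType) (N : nat) (X : set (config A)) (B : int) :
  uniform_gap N X ->
  forall (n : nat) (O1 O2 : set int) (x1 x2 : config A), X x1 -> X x2 ->
  (forall h : int, O1 h \/ O2 h -> B <= h < B + n%:Z) ->
  (forall h k : int, O1 h -> O2 k -> (N < `|h - k|)%N) ->
  exists z : config A, [/\ X z, forall h : int, O1 h -> z h = x1 h
                         & forall h : int, O2 h -> z h = x2 h].
Proof.
move=> gapX n; elim/ltn_ind: n => n IHn.
have glue O1 O2 x1 x2 l1 l2 : X x1 -> X x2 ->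
    (forall h : int, O1 h \/ O2 h -> B <= h < B + n%:Z) ->
    (forall h k : int, O1 h -> O2 k -> (N < `|h - k|)%N) ->
    O1 l1 -> O2 l2 -> (forall h : int, O2 h -> h <= l2) -> l2 < l1 ->
    exists z : config A, [/\ X z, forall h : int, O1 h -> z h = x1 h
                           & forall h : int, O2 h -> z h = x2 h].
  move=> Xx1 Xx2 OB sep Ol1 Ol2 l2max l21.
  have B1 := OB _ (or_introl Ol1); have B2 := OB _ (or_intror Ol2).
  (* The window now stops at [l2]; it is strictly shorter because [l1] lies beyond [l2]. *)
  have [||h k [Oh _]|z [Xz z1 z2]] := IHn `|(l2 + 1)%R - B|%N _
    (O1 `&` [set h | h <= l2]) O2 x1 x2 Xx1 Xx2.
  - by lia.
  - move=> h Oh; have ? : B <= h < B + n%:Z.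
      by apply: OB; case: Oh => [[]|]; [left|right].
    have ? : h <= l2 by case: Oh => [[]|/l2max].
    by lia.
  - exact: sep.
  have [w [Xw wz wx]] := gapX z x1 B (l2 + 1) (l2 + 1 + N%:Z) (B + n%:Z) Xz Xx1
    (lexx _).
  exists w; split=> // h Oh.
    have hB := OB _ (or_introl Oh); case: (leP h l2) => hl.
      by rewrite wz ?z1 //; lia.
    (* A point of [O1] beyond [l2] is more than [N] away from it, hence at least [l2 + 1 + N]. *)
    by apply: wx; have := sep _ _ Oh Ol2; lia.
  have hB := OB _ (or_intror Oh).
  by rewrite wz ?z2 //; have := l2max _ Oh; lia.
move=> O1 O2 x1 x2 Xx1 Xx2 OB sep.
have [->|/set0P O1n] := eqVneq O1 set0; first by exists x2.
have [->|/set0P O2n] := eqVneq O2 set0; first by exists x1.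
have [l1 Ol1 l1max] := exists_max_int (fun h Oh => OB h (or_introl Oh)) O1n.
have [l2 Ol2 l2max] := exists_max_int (fun h Oh => OB h (or_intror Oh)) O2n.
have [l12|l21|l12] := ltgtP l1 l2.
- have [||z [Xz z2 z1]] := glue O2 O1 x2 x1 l2 l1 Xx2 Xx1 _ _ Ol2 Ol1 l1max l12.
  + by move=> h [Oh|Oh]; apply: OB; [right|left].
  + by move=> h k Oh Ok; rewrite distnC; exact: sep.
  by exists z.
- exact: (glue O1 O2 x1 x2 l1 l2).
- by have := sep _ _ Ol1 Ol2; lia.
Qed.

Lemma uniform_gap_strongly_irreducible (A : finType) (N : nat)
    (X : set (config A)) :
  uniform_gap N X -> strongly_irreducible X.
Proof.
move=> gapX; exists [set d : int | (`|d| <= N)%N]; first exact: finite_set_int_ball.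
move=> O1 O2 /finite_set_int_bounded[M1 OM1] /finite_set_int_bounded[M2 OM2].
move=> disj x1 x2 Xx1 Xx2.
apply: (@uniform_gap_glue _ N X (- (M1 + M2)%:Z) gapX (2 * (M1 + M2)).+1) => //.
  by move=> h [/OM1|/OM2]; lia.
move=> h k Oh Ok; rewrite ltnNge; apply/negP => hk.
have : (dilation O1 [set d : int | (`|d| <= N)%N] `&` O2) k.
  split=> //; exists h; split=> //; exists (h - k) => //.
  by rewrite addrC subrK.
by rewrite disj.
Qed.

(** * Paths in the graph and the uniform gap *)

Section Sofic.
Variables (A : finType) (G : labeled_graph A).
Implicit Types (p q r : int -> edge G) (x y : config A).

Lemma biinfinite_path_translate p (c : int) :
  biinfinite_path p -> biinfinite_path (fun h => p (h + c)).
Proof. by move=> pP n; rewrite pP addrAC. Qed.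

Lemma biinfinite_path_splice p q (m : int) :
  biinfinite_path p -> biinfinite_path q -> source (p m) = source (q m) ->
  biinfinite_path (fun h => if h < m then p h else q h).
Proof.
move=> pP qP pq n.
have [n1|n1] := ltP (n + 1) m; first by rewrite (_ : n < m) ?pP //; lia.
have [n2|n2] := ltP n m; last exact: qP.
by rewrite pP (_ : n + 1 = m) //; lia.
Qed.

(** With [b = m] these are the vertices where the word of [x] on [[a, m)] can end; with [a = m],
    those where the word on [[m, b)] can start. *)
Definition passing (x : config A) (a b m : int) : {set vertex G} :=
  [set v | `[< exists p : int -> edge G, [/\ biinfinite_path p, source (p m) = v
                         & forall h : int, a <= h < b -> x h = label (p h)] >]].

Definition connected_in (k : nat) (S T : {set vertex G}) : Prop :=
  exists r, [/\ biinfinite_path r, source (r 0) \in S & source (r k%:Z) \in T].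

(** Splice three paths: one reading [x] up to [m], the connecting path [r] translated to start at
    [m], and from [m + k] on one reading [y]. *)
Lemma connected_in_glue x y (a m b : int) (k : nat) :
  connected_in k (passing x a m m) (passing y (m + k%:Z) b (m + k%:Z)) ->
  exists z : config A, [/\ graph_shift G z, forall h : int, a <= h < m -> z h = x h
                         & forall h : int, m + k%:Z <= h < b -> z h = y h].
Proof.
move=> [r [rP]]; rewrite /passing !inE.
move=> [p [pP pm px]] [q [qP qn qy]].
pose r' h := r (h + - m).
have pr'P : biinfinite_path (fun h => if h < m then p h else r' h).
  apply: biinfinite_path_splice => //; first exact: biinfinite_path_translate.
  by rewrite /r' subrr pm.
pose w h := if h < m + k%:Z then if h < m then p h else r' h else q h.
have wP : biinfinite_path w.
  apply: biinfinite_path_splice => //.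
  rewrite ifF; last by lia.
  by rewrite /r' (_ : m + _ - _ = k%:Z) ?qn //; lia.
exists (fun h => label (w h)); split; first by exists w.
  by move=> h hm; rewrite px // /w ifT ?ifT //; lia.
by move=> h hn; rewrite qy // /w ifF //; lia.
Qed.

Lemma mixing_connected_in x y (a m n b : int) :
  topologically_mixing (graph_shift G) -> graph_shift G x -> graph_shift G y ->
  exists K : nat, forall k : nat, (K <= k)%N ->
    connected_in k (passing x a m m) (passing y n b n).
Proof.
move=> mixG Gx Gy.
(* The ball of radius [N] contains both [[a, m)] and [[n, b)]. *)
pose N := (`|a| + `|b| + `|m| + `|n|)%N.
have [||F finF mixF] := mixG _ _ (open_in_cylinder N (graph_shift G) x)
  (open_in_cylinder N (graph_shift G) y).
- by exists x.
- by exists y.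
have [M MF] := finite_set_int_bounded finF.
exists (M + N).+1 => k Kk.
(* This shift moves position [n] of [y] to [m + k], so a path reading [z] leaves the word of [x] at
   [m] and enters that of [y] exactly [k] edges later. *)
have [|z [[[p pP pz] zx] [y' [_ y'y] y'z]]] := mixF (m + k%:Z - n).
  by move=> /MF; lia.
exists (fun h => p (h + m)); split; first exact: biinfinite_path_translate.
  rewrite /passing inE add0r; apply/asboolP; exists p; split=> // h hm.
  by rewrite -pz zx //; lia.
rewrite /passing inE; apply/asboolP.
exists (fun h => p (h + (m + k%:Z - n))); split.
- exact: biinfinite_path_translate.
- by congr (source (p _)); lia.
- by move=> h hn; rewrite -pz -y'z /shift addrK y'y //; lia.
Qed.

Lemma mixing_uniform_gap :
  topologically_mixing (graph_shift G) ->
  exists N, uniform_gap N (graph_shift G).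
Proof.
move=> mixG.
(* The threshold depends on the pair of vertex sets alone, so its maximum over the finitely many
   pairs exists. Pairs that are not eventually connected get the dummy value 0; mixing ensures that
   none of them comes from two words. *)
have /choice[K KP] (ST : {set vertex G} * {set vertex G}) : exists K : nat,
    (exists K' : nat, forall k, (K' <= k)%N -> connected_in k ST.1 ST.2) ->
    forall k, (K <= k)%N -> connected_in k ST.1 ST.2.
  by have [[K KST]|no] := pselect (exists K' : nat, forall k, (K' <= k)%N ->
    connected_in k ST.1 ST.2); [exists K|exists 0%N].
exists (\max_ST K ST) => x y a m n b Gx Gy mn.
have -> : n = m + `|n - m|%N%:Z by lia.
apply: connected_in_glue.
apply: (KP (_, _)); first exact: mixing_connected_in.
by apply: leq_trans (leq_bigmax _) _; lia.
Qed.

End Sofic.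

Theorem corollary1p3 (A : finType) (X : set (config A)) :
  subshift X -> sofic X ->
  (strongly_irreducible X <-> topologically_mixing X).
Proof.
move=> [_ shX] [G XG]; split; first exact: strongly_irreducible_mixing.
rewrite XG => /mixing_uniform_gap[N].
exact: uniform_gap_strongly_irreducible.
Qed.
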